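(* Let $k\ge 2$ be an integer and let $q_1\ge q_2\ge\cdots\ge q_k\ge 1$ be integers. Let $a_0,\dots,a_{k-1}$ be nonnegative integers, at least one of which is nonzero, and let $\{\mathcal{V}^{(k)}_n\}_{n\ge 0}$ be the integer sequence with $\mathcal{V}^{(k)}_i=a_i$ for $0\le i\le k-1$ and $\mathcal{V}^{(k)}_n=\sum_{i=1}^k q_i\,\mathcal{V}^{(k)}_{n-i}$ for $n\ge k$. Then $$\lim_{n\to\infty}\frac{\mathcal{V}^{(k)}_n}{\mathcal{V}^{(k)}_{n-1}}=\alpha,$$ where $\alpha$, with $q_1<\alpha<q_1+1$, is the positive real zero of $f(x)=x^k-q_1x^{k-1}-q_2x^{k-2}-\cdots-q_{k-1}x-q_k$.
   Context: Under the stated assumptions on $q_1,\dots,q_k$, it is known that $f$ has exactly one positive real zero $\alpha$, and that $q_1<\alpha<q_1+1$. *)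

(* Defs.v *)
From HB Require Import structures.
From mathcomp Require Import all_boot all_order all_algebra.
From mathcomp Require Import all_classical all_reals all_analysis.
Set Implicit Arguments.
Unset Strict Implicit.
Unset Printing Implicit Defensive.
Import Order.TTheory GRing.Theory Num.Theory.
Import numFieldNormedType.Exports.

Local Open Scope ring_scope.

(* q is indexed from 1; only q 1, ..., q k are used. *)
Definition recpoly (R : nzRingType) (k : nat) (q : nat -> int) : {poly R} :=
  'X^k - \sum_(1 <= i < k.+1) (q i)%:~R *: 'X^(k - i).

(* Since n >= k, the truncated subtraction n - i never truncates. *)
Definition linrec (k : nat) (q a V : nat -> int) : Prop :=
  (forall i, (i < k)%N -> V i = a i) /\
  (forall n, (k <= n)%N -> V n = \sum_(1 <= i < k.+1) q i * V (n - i)%N).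

(* Main.v *)
(* For x > 0, f(x) = x^k (1 - g(x)) with g(x) = sum_i q_i / x^i strictly
   decreasing, g(q_1) > 1 and g(q_1 + 1) < 1, which gives the unique zero alpha.
   The numbers q_i / alpha^i are then positive weights of sum 1, and
   W_n = V_n / alpha^n is the weighted average of its k predecessors.  Hence W
   stays in the range of any window of k consecutive terms, and this range
   shrinks by a fixed factor from one window to the next.  As W is bounded below
   by a positive constant, W_n / W_(n-1) tends to 1. *)

Require Import Defs.
From HB Require Import structures.
From mathcomp Require Import all_boot all_order all_algebra.
From mathcomp Require Import all_classical all_reals all_analysis.
From mathcomp Require Import zify ring lra.
Set Implicit Arguments.
Unset Strict Implicit.
Unset Printing Implicit Defensive.
Import Order.TTheory GRing.Theory Num.Theory.
Import numFieldNormedType.Exports.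

Local Open Scope classical_set_scope.
Local Open Scope ring_scope.

(** * Sequences that are weighted averages of their [k] predecessors *)

Definition averaging (R : realFieldType) (k : nat) (p W : nat -> R) : Prop :=
  forall n, (k <= n)%N -> W n = \sum_(1 <= i < k.+1) p i * W (n - i)%N.

Definition weights (R : realFieldType) (k : nat) (p : nat -> R) : Prop :=
  [/\ (0 < k)%N, forall i, (1 <= i <= k)%N -> 0 < p i
    & \sum_(1 <= i < k.+1) p i = 1].

Lemma averagingN (R : realFieldType) (k : nat) (p W : nat -> R) :
  averaging k p W -> averaging k p (fun n => - W n).
Proof.
move=> avW n kn; rewrite avW // -sumrN.
by apply: eq_bigr => i _; rewrite mulrN.
Qed.

(** As the weights sum to 1, [u - W n] is the same average of the gaps [u - W (n - i)]; these are
    nonnegative, so the term [i = 1] alone bounds it from below. *)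
Lemma averaging_gap (R : realFieldType) (k : nat) (p W : nat -> R) (u : R) n :
    weights k p -> averaging k p W -> (k <= n)%N ->
    (forall j, (n - k <= j < n)%N -> W j <= u) ->
  p 1%N * (u - W n.-1) <= u - W n.
Proof.
move=> [k0 p0 p1] avW kn Wu.
have -> : u - W n = \sum_(1 <= i < k.+1) p i * (u - W (n - i)%N).
  rewrite avW // -{1}[u]mul1r -p1 mulr_suml -sumrB.
  by apply: eq_bigr => i _; rewrite mulrBr.
rewrite big_ltn // subn1 lerDl big_nat; apply: sumr_ge0 => i ik.
rewrite mulr_ge0 ?subr_ge0 ?Wu //; last lia.
by rewrite ltW // p0; lia.
Qed.

Lemma averaging_le (R : realFieldType) (k : nat) (p W : nat -> R) (u : R) n :
    weights k p -> averaging k p W ->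
    (forall j, (n <= j < n + k)%N -> W j <= u) ->
  forall j, (n <= j)%N -> W j <= u.
Proof.
move=> wp avW Wu j; have [k0 p0 _] := wp.
elim/ltn_ind: j => j IH nj.
have [jk|kj] := ltnP j (n + k); first by apply: Wu; lia.
have := averaging_gap (u := u) (n := j) wp avW.
have p10 : 0 <= p 1%N by rewrite ltW // p0; lia.
move=> H; rewrite -subr_ge0; apply: le_trans (H _ _); last 2 first.
- lia.
- by move=> i ij; apply: IH; lia.
by rewrite mulr_ge0 // subr_ge0 IH //; lia.
Qed.

Lemma weight1_le1 (R : realFieldType) (k : nat) (p : nat -> R) :
  weights k p -> p 1%N <= 1.
Proof.
move=> [k0 p0 <-]; rewrite big_ltn // lerDl big_nat.
by apply: sumr_ge0 => i ik; rewrite ltW // p0; lia.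
Qed.

(* A term far from the upper bound forces its successor to be far from it,
   because the weight of the most recent term is positive. *)
Lemma averaging_shrink (R : realFieldType) (k : nat) (p W : nat -> R)
    (l u : R) n :
    weights k p -> averaging k p W ->
    (forall j, (n <= j)%N -> W j <= u) ->
    W (n + k).-1 <= (l + u) / 2 -> l <= u ->
  forall j, (n + k <= j)%N -> W j <= u - p 1%N ^+ k / 2 * (u - l).
Proof.
move=> wp avW Wu Wm lu; have [k0 p0 _] := wp.
have p10 : 0 < p 1%N by apply: p0; lia.
(* Each step away from the last term of the window costs at most a factor [p 1]. *)
have gap i : p 1%N ^+ i * (u - W (n + k).-1) <= u - W ((n + k).-1 + i)%N.
  elim: i => [|i IH]; first by rewrite mul1r addn0.
  rewrite exprS -mulrA; apply: le_trans (_ : _ <= p 1%N * (u - W ((n + k).-1 + i)%N)) _.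
    by rewrite ler_pM2l.
  rewrite addnS; apply: (@averaging_gap R k p W u _.+1 wp avW); first lia.
  by move=> j jn; apply: Wu; lia.
(* Only the next window matters; it is reached in at most [k] steps. *)
apply: (averaging_le wp avW) => j jn.
have := gap (j - (n + k).-1)%N; rewrite subnKC; last lia.
set i := (j - _)%N => h.
have ik : (i <= k)%N by rewrite /i; lia.
have p1k : p 1%N ^+ k <= p 1%N ^+ i.
  by rewrite ler_wiXn2l // ?(ltW p10) // (weight1_le1 wp).
have d0 : (u - l) / 2 <= u - W (n + k).-1 by lra.
have := ler_pM (exprn_ge0 k (ltW p10)) _ p1k d0.
lra.
Qed.

(** The last term of the window lies in one half of [[l, u]], and the opposite endpoint moves
    inwards. The upper half reduces to the lower one by passing to [- W]. *)
Lemma averaging_contract (R : realFieldType) (k : nat) (p W : nat -> R)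
    (l u : R) n :
    weights k p -> averaging k p W ->
    (forall j, (n <= j)%N -> l <= W j <= u) ->
  exists l' u', [/\ l <= l', u' - l' = (1 - p 1%N ^+ k / 2) * (u - l)
    & forall j, (n + k <= j)%N -> l' <= W j <= u'].
Proof.
move=> wp avW Wlu; have [k0 p0 _] := wp.
have lu : l <= u by have /andP[a b] := Wlu n (leqnn n); apply: le_trans b.
have c0 : 0 <= p 1%N ^+ k by rewrite exprn_ge0 // ltW // p0; lia.
have d0 : 0 <= p 1%N ^+ k / 2 * (u - l) by rewrite mulr_ge0 //; lra.
have [Wm|/ltW Wm] := leP (W (n + k).-1) ((l + u) / 2).
  exists l, (u - p 1%N ^+ k / 2 * (u - l)); split=> //; first by ring.
  move=> j jn; apply/andP; split; first by have /andP[] := Wlu j ltac:(lia).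
  apply: (averaging_shrink wp avW) jn => // i /Wlu /andP[] //.
exists (l + p 1%N ^+ k / 2 * (u - l)), u; split; [lra|by ring|].
move=> j jn; apply/andP; split; last by have /andP[] := Wlu j ltac:(lia).
have := @averaging_shrink R k p (fun n => - W n) (- u) (- l) n wp
  (averagingN avW) _ _ _ j jn.
have h1 : forall j, (n <= j)%N -> - W j <= - l.
  by move=> i /Wlu /andP[h _]; rewrite lerN2.
move=> /(_ h1) H; have := H ltac:(lra) ltac:(lra); lra.
Qed.

Lemma averaging_osc (R : realFieldType) (k : nat) (p W : nat -> R)
    (l u : R) n :
    weights k p -> averaging k p W ->
    (forall j, (n <= j)%N -> l <= W j <= u) ->
  forall t i j, (n + t * k <= i)%N -> (n + t * k <= j)%N ->
    `|W i - W j| <= (1 - p 1%N ^+ k / 2) ^+ t * (u - l).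
Proof.
move=> wp avW Wlu t.
have [l' [u' [<- Wlu']]] : exists l' u',
    u' - l' = (1 - p 1%N ^+ k / 2) ^+ t * (u - l) /\
    forall j, (n + t * k <= j)%N -> l' <= W j <= u'.
  elim: t => [|t [l' [u' [e Wlu']]]].
    by exists l, u; split; [rewrite mul1r|rewrite mul0n addn0].
  have [l2 [u2 [_ e2 h2]]] := averaging_contract wp avW Wlu'.
  exists l2, u2; split; first by rewrite e2 e exprS mulrA.
  by move=> j jn; apply: h2; lia.
move=> i j /Wlu' /andP[i1 i2] /Wlu' /andP[j1 j2].
by rewrite ler_norml; apply/andP; split; lra.
Qed.

Lemma averaging_ratio_cvg (R : realType) (k : nat) (p W : nat -> R)
    (l u : R) n :
    weights k p -> averaging k p W -> 0 < l ->
    (forall j, (n <= j)%N -> l <= W j <= u) ->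
  (fun j => W j / W j.-1) @ \oo --> (1 : R).
Proof.
move=> wp avW l0 Wlu; have [k0 p0 _] := wp.
have p10 : 0 < p 1%N by apply: p0; lia.
have c0 : 0 < p 1%N ^+ k <= 1.
  by rewrite exprn_gt0 //= exprn_ile1 ?(ltW p10) // (weight1_le1 wp).
set c := 1 - p 1%N ^+ k / 2.
have c1 : `|c| < 1 by rewrite ltr_norml /c; apply/andP; split; lra.
have /cvgrPdist_lt cv : (fun t => c ^+ t * (u - l)) @ \oo --> (0 : R).
  by rewrite -(mul0r (u - l)); apply: cvgM; [exact: cvg_expr|exact: cvg_cst].
apply/cvgrPdist_lt => e e0.
(* The factor [l] compensates the later division by [W j.-1 >= l]. *)
have [t _ /(_ t (leqnn t))] := cv (e * l) (mulr_gt0 e0 l0).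
rewrite /= sub0r normrN => ht.
(* The successor keeps [j.-1] in the range of the oscillation bound too. *)
exists (n + t * k).+1 => // j /= jn.
have /andP[lW _] := Wlu j.-1 ltac:(lia).
have W0 : 0 < W j.-1 by apply: lt_le_trans lW.
rewrite -(divff (lt0r_neq0 W0)) -mulrBl normrM normfV (gtr0_norm W0).
rewrite ltr_pdivrMr //.
apply: le_lt_trans (_ : c ^+ t * (u - l) < _).
  by apply: (averaging_osc wp avW Wlu); lia.
apply: le_lt_trans (ler_norm _) _; apply: lt_le_trans ht _.
by rewrite ler_pM2l.
Qed.

(** * The positive zero of the characteristic polynomial *)

Lemma recpoly_horner (R : fieldType) (k : nat) (q : nat -> int) (x : R) :
  x != 0 ->
  (recpoly R k q).[x] = x ^+ k * (1 - \sum_(1 <= i < k.+1) (q i)%:~R / x ^+ i).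
Proof.
move=> x0; rewrite /recpoly hornerD hornerN hornerXn horner_sum mulrBr mulr1.
congr (_ - _); rewrite mulr_sumr; apply: eq_big_nat => i ik.
rewrite hornerZ hornerXn mulrCA; congr (_ * _).
by rewrite expfB_cond // (negbTE x0) /=; lia.
Qed.

Lemma root_recpoly (R : fieldType) (k : nat) (q : nat -> int) (x : R) :
  x != 0 ->
  root (recpoly R k q) x = (\sum_(1 <= i < k.+1) (q i)%:~R / x ^+ i == 1).
Proof.
move=> x0; rewrite /root recpoly_horner // mulf_eq0 expf_eq0 (negbTE x0) andbF /=.
by rewrite subr_eq0 eq_sym.
Qed.

(** The sum telescopes. At [x = q 1 + 1] its numerators become [q 1], which dominates every
    coefficient. *)
Lemma geometric_inverse_sum (R : fieldType) (k : nat) (x : R) : x != 0 ->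
  \sum_(1 <= i < k.+1) (x - 1) / x ^+ i = 1 - (x ^+ k)^-1.
Proof.
move=> x0; elim: k => [|k IH]; first by rewrite big_geq // invr1 subrr.
rewrite big_nat_recr //= IH exprS; field.
by rewrite x0 expf_neq0.
Qed.

(** Every summand is strictly decreasing on the positive axis; this yields uniqueness of the
    zero. *)
Lemma sum_inverse_powers_inj (R : realFieldType) (k : nat) (c : nat -> R)
    (x y : R) :
    (0 < k)%N -> (forall i, (1 <= i <= k)%N -> 0 < c i) -> 0 < x -> 0 < y ->
    \sum_(1 <= i < k.+1) c i / x ^+ i = \sum_(1 <= i < k.+1) c i / y ^+ i ->
  x = y.
Proof.
move=> k0 c0.
wlog xy : x y / x < y => [H x0 y0 e|x0 y0 /eqP].
  by have [/H|/H h|//] := ltgtP x y; [apply|apply/esym/h].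
suff /lt_eqF h : \sum_(1 <= i < k.+1) c i / y ^+ i < \sum_(1 <= i < k.+1) c i / x ^+ i.
  by rewrite eq_sym h.
apply: ltr_sum_nat => // i ik.
rewrite ltr_pM2l ?c0 //.
by rewrite ltf_pV2 ?posrE ?exprn_gt0 // ltrXn2r ?(ltW x0) //; lia.
Qed.

Lemma noninc_bounds (k : nat) (q : nat -> int) :
    (forall i, (1 <= i < k)%N -> q i.+1 <= q i) -> 1 <= q k ->
  forall i, (1 <= i <= k)%N -> 1 <= q i <= q 1%N.
Proof.
move=> qn qk.
have le1 i : (1 <= i <= k)%N -> q i <= q 1%N.
  elim: i => // -[//|i] IH ik.
  by apply: le_trans (qn _ _) (IH _); lia.
have ge1 d : (d < k)%N -> 1 <= q (k - d)%N.
  elim: d => [|d IH] dk; first by rewrite subn0.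
  apply: le_trans (IH _) _; first lia.
  have -> : (k - d = (k - d.+1).+1)%N by lia.
  by apply: qn; lia.
move=> i ik; rewrite le1 // andbT.
by have := ge1 (k - i)%N; rewrite subKn; [apply; lia|lia].
Qed.

Lemma recpoly_root_exists (R : realType) (k : nat) (q : nat -> int) :
    (2 <= k)%N -> (forall i, (1 <= i <= k)%N -> 1 <= q i <= q 1%N) ->
  exists2 x : R, (q 1%N)%:~R < x < (q 1%N)%:~R + 1 & root (recpoly R k q) x.
Proof.
move=> k2 qb; set b : R := (q 1%N)%:~R.
have b1 : 1 <= b by have /andP[h _] := qb 1%N ltac:(lia); rewrite /b ler1z.
have b_gt0 : 0 < b by lra.
have b1_gt0 : 0 < b + 1 by lra.
have b0 := lt0r_neq0 b_gt0; have b10 := lt0r_neq0 b1_gt0.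
(* At [b] the first summand is exactly 1, and the second, present since [k >= 2], pushes the sum
   above 1. *)
have low : (recpoly R k q).[b] < 0.
  rewrite recpoly_horner // pmulr_rlt0 ?exprn_gt0 //.
  rewrite subr_lt0 big_ltn ?expr1 ?divff; [|by []|lia].
  rewrite big_ltn; last lia.
  rewrite ltrDl ltr_pwDl //.
    rewrite divr_gt0 ?(exprn_gt0 _ b_gt0) // ltr0z.
    by have := qb 2%N ltac:(lia); lia.
  rewrite big_nat; apply: sumr_ge0 => i ik.
  rewrite divr_ge0 ?(exprn_ge0 _ (ltW b_gt0)) // ler0z.
  by have := qb i ltac:(lia); lia.
have high : 0 < (recpoly R k q).[b + 1].
  rewrite recpoly_horner // pmulr_rgt0 ?exprn_gt0 //.
  rewrite subr_gt0.
  apply: le_lt_trans (_ : _ <= \sum_(1 <= i < k.+1) (b + 1 - 1) / (b + 1) ^+ i) _.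
    apply: ler_sum_nat => i ik.
    rewrite ler_pM2r ?invr_gt0 ?exprn_gt0 //.
    by rewrite addrK ler_int; have := qb i ltac:(lia); lia.
  by rewrite geometric_inverse_sum // gtrBl invr_gt0 exprn_gt0.
have [||x /andP[bx xb] rx] := @poly_ivt R (recpoly R k q) b (b + 1).
- by rewrite lerDl.
- by rewrite (ltW low) (ltW high).
(* The intermediate value theorem gives a closed interval; the nonzero values at its ends exclude
   them. *)
exists x => //; rewrite !lt_def bx xb !andbT; apply/andP; split.
  by apply: contraTneq rx => ->; rewrite /root lt_eqF.
by rewrite eq_sym; apply: contraTneq rx => ->; rewrite /root gt_eqF.
Qed.

(** * Positivity of the integer sequence and convergence of its ratios *)

Lemma linrec_gt0 (k : nat) (q a V : nat -> int) :
    (forall i, (1 <= i <= k)%N -> 0 < q i) ->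
    (forall i, (i < k)%N -> 0 <= a i) ->
    (exists2 i, (i < k)%N & a i != 0) -> linrec k q a V ->
  forall n, (k <= n)%N -> 0 < V n.
Proof.
move=> q0 a0 [i0 i0k ai0] [Va Vr].
have V0 n : 0 <= V n.
  elim/ltn_ind: n => n IH; have [nk|kn] := ltnP n k; first by rewrite Va ?a0.
  rewrite Vr // big_nat; apply: sumr_ge0 => i ik.
  by apply: mulr_ge0; [apply/ltW/q0; lia|apply: IH; lia].
(* One positive term among the [k] predecessors suffices: a nonzero initial value for [V k], the
   preceding term afterwards. *)
have pos n i : (k <= n)%N -> (1 <= i <= k)%N -> 0 < V (n - i)%N -> 0 < V n.
  move=> kn ik Vi; rewrite Vr // (bigD1_seq i) ?mem_index_iota ?iota_uniq //=.
  rewrite ltr_pwDl ?mulr_gt0 ?q0 //.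
  rewrite big_seq_cond; apply: sumr_ge0 => j; rewrite mem_index_iota => /andP[jk _].
  by rewrite mulr_ge0 //; apply/ltW/q0; lia.
elim=> [|n IH] kn; first by lia.
have [kn1|nk] := leqP k n; first by apply: (pos _ 1%N); rewrite ?subn1; [lia|lia|apply: IH].
apply: (pos _ (n.+1 - i0)%N); [lia|lia|rewrite subKn; last lia].
by rewrite Va // lt_def ai0 a0.
Qed.

Theorem corollary2p10 (R : realType) (k : nat) (q a V : nat -> int)
    (k_ge2 : (2 <= k)%N)
    (q_noninc : forall i, (1 <= i < k)%N -> q i.+1 <= q i)
    (qk_ge1 : 1 <= q k)
    (a_ge0 : forall i, (i < k)%N -> 0 <= a i)
    (a_neq0 : exists2 i, (i < k)%N & a i != 0)
    (V_rec : linrec k q a V) :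
  exists alpha : R,
    [/\ 0 < alpha /\ root (recpoly R k q) alpha,
        forall x : R, 0 < x -> root (recpoly R k q) x -> x = alpha,
        (q 1%N)%:~R < alpha < (q 1%N)%:~R + 1
      & (fun n : nat => (V n)%:~R / (V n.-1)%:~R : R) @ \oo --> alpha].
Proof.
have qb := noninc_bounds q_noninc qk_ge1.
have q0 i : (1 <= i <= k)%N -> 0 < q i by move=> /qb; lia.
have q0R i : (1 <= i <= k)%N -> 0 < (q i)%:~R :> R by move=> /q0; rewrite ltr0z.
have [alpha qalpha root_alpha] := recpoly_root_exists R k_ge2 qb.
have q1R : 1 <= (q 1%N)%:~R :> R by rewrite ler1z; have := q0 1%N ltac:(lia); lia.
have alpha1 : 1 < alpha by have /andP[h _] := qalpha; apply: le_lt_trans h.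
have alpha0 : 0 < alpha by apply: lt_trans alpha1.
have alphaN0 := lt0r_neq0 alpha0.
exists alpha; split=> // [x x0 root_x|].
  apply: (@sum_inverse_powers_inj R k (fun i => (q i)%:~R)) => //; first lia.
  have xN0 := lt0r_neq0 x0.
  by move: root_x root_alpha; rewrite !root_recpoly // => /eqP-> /eqP->.
have V0 := linrec_gt0 q0 a_ge0 a_neq0 V_rec.
pose p i : R := (q i)%:~R / alpha ^+ i.
pose W n : R := (V n)%:~R / alpha ^+ n.
have wp : weights k p.
  split; [lia| |by apply/eqP; rewrite -root_recpoly].
  by move=> i ik; rewrite divr_gt0 ?exprn_gt0 ?q0R.
have avW : averaging k p W.
  move=> n kn; rewrite /W V_rec.2 // rmorph_sum mulr_suml.
  apply: eq_big_nat => i ik; rewrite rmorphM /= /p mulrACA -invfM -exprD.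
  by rewrite subnKC //; lia.
have W0 n : (k <= n)%N -> 0 < W n.
  by move=> kn; rewrite divr_gt0 ?exprn_gt0 // ltr0z V0.
(* The terms of this window are positive, so their sum bounds each of them. *)
pose u := \sum_(k <= j < k + k) W j.
have Wu : forall j, (k <= j)%N -> W j <= u.
  apply: (averaging_le wp avW) => j jk.
  rewrite /u (bigD1_seq j) ?mem_index_iota ?iota_uniq //= lerDl.
  rewrite big_seq_cond; apply: sumr_ge0 => i.
  by rewrite mem_index_iota => /andP[ik _]; apply/ltW/W0; lia.
(* On the first window [V j >= 1] by integrality and [alpha ^+ j <= alpha ^+ (k + k)]. *)
have Wl : forall j, (k <= j)%N -> - W j <= - (alpha ^+ (k + k))^-1.
  apply: (averaging_le wp (averagingN avW)) => j jk.
  rewrite lerN2 /W -[leLHS]mul1r ler_pM ?invr_ge0 ?exprn_ge0 ?(ltW alpha0) //.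
    by rewrite ler1z; have := V0 j ltac:(lia); lia.
  rewrite lef_pV2 ?posrE ?exprn_gt0 // ler_eXn2l //; lia.
have rW : (fun j => W j / W j.-1) @ \oo --> (1 : R).
  apply: (@averaging_ratio_cvg R k p W (alpha ^+ (k + k))^-1 u k) => //.
    by rewrite invr_gt0 exprn_gt0.
  by move=> j kj; rewrite Wu // andbT -lerN2 Wl.
have aW : (fun j => alpha * (W j / W j.-1)) @ \oo --> alpha.
  by rewrite -[X in _ --> X]mulr1; apply: cvgM rW; exact: cvg_cst.
apply: cvg_trans aW.
(* From [k.+1] on the preceding index is at least [k], so the denominator is positive and the powers
   of [alpha] cancel. *)
apply: near_eq_cvg; exists k.+1 => // -[//|n] /= kn.
rewrite /W exprS; field.
by rewrite alphaN0 expf_neq0 //= intr_eq0 gt_eqF // V0.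
Qed.
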